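(* Let $d\in\{-1,-2,-3,-7,-11\}$, let $K=\mathbb{Q}(\sqrt{d})$, and let $\mathcal{O}_K$ be its ring of integers, with $|\cdot|$ the complex absolute value. There exists an algorithm which, given $N,S,r\in\mathcal{O}_K$ with $\gcd(N,S)=\gcd(S,r)=1$, outputs the divisors $D$ of $N$ in $\mathcal{O}_K$ of the form $D=Sx+r$ for some $x\in\mathcal{O}_K$. When $|S|^3>|N|$, the algorithm runs in $O(\log|N|)$ elementary operations in $\mathcal{O}_K$.
   Context: ''Elementary operations'' means additions, multiplications, subtractions, (Euclidean) integer divisions, and square root extractions. *)

(* Defs.v *)
From HB Require Import structures.
From mathcomp Require Import all_boot all_order all_algebra.
From mathcomp Require Import complex ring.
From mathcomp Require Import boolp classical_sets reals exp.

Set Implicit Arguments.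
Unset Strict Implicit.
Unset Printing Implicit Defensive.

Import Order.TTheory GRing.Theory Num.Theory.

Local Open Scope ring_scope.

Section RingOfIntegers.
Variables (R : realType) (d : int).

(* Q(sqrt d) as a subfield of the complex numbers R[i] *)
Definition in_quadfield (z : R[i]) : Prop :=
  exists a b : rat, z = ratr a + ratr b * sqrtC d%:~R.

Definition quadint_pred : pred R[i] :=
  fun z => `[< in_quadfield z /\ integralOver (intr : int -> R[i]) z >].

Fact quadint_subring : subring_closed quadint_pred.
Proof.
have sq : sqrtC (d%:~R : R[i]) * sqrtC d%:~R = ratr d%:~R.
  by rewrite -expr2 sqrtCK ratr_int.
split=> [|x y|x y].
- apply/asboolP; split; last exact: integral1.
  by exists 1, 0; rewrite rmorph1 rmorph0 mul0r addr0.
- move=> /asboolP[[a [b ->]] ix] /asboolP[[a' [b' ->]] iy]; apply/asboolP.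
  split; last exact: integral_sub.
  by exists (a - a'), (b - b'); rewrite !rmorphB mulrBl addrACA opprD.
- move=> /asboolP[[a [b ->]] ix] /asboolP[[a' [b' ->]] iy]; apply/asboolP.
  split; last exact: integral_mul.
  exists (a * a' + b * b' * d%:~R), (a * b' + b * a').
  by rewrite !rmorphD !rmorphM /= -sq; ring.
Qed.

HB.instance Definition _ :=
  GRing.isSubringClosed.Build R[i] quadint_pred quadint_subring.

Record quadint := QuadInt { quadval : R[i]; _ : quadint_pred quadval }.

HB.instance Definition _ := [isSub for quadval].
HB.instance Definition _ := [Choice of quadint by <:].
HB.instance Definition _ := [SubChoice_isSubComNzRing of quadint by <:].

Definition qabs (x : quadint) : R := Normc.normc (quadval x).

Definition qdvd (a b : quadint) : Prop := exists c, b = c * a.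

(* gcd(a, b) = 1 *)
Definition qcoprime (a b : quadint) : Prop :=
  forall g, qdvd g a -> qdvd g b -> qdvd g 1.

(* Euclidean quotient: an element of O_K nearest to a / b, so that the
   remainder a - b * qquo a b has least absolute value; ties are broken by an
   unspecified choice, and qquo a 0 = 0. *)
Definition qquo (a b : quadint) : quadint :=
  if b == 0 then 0
  else xget 0 [set q | forall q', qabs (a - b * q) <= qabs (a - b * q')]%classic.

(* A square root of z in O_K (unspecified sign) if there is one, else 0. *)
Definition qsqrt (z : quadint) : quadint := xget 0 [set w | w ^+ 2 = z]%classic.

(* Programs: while-programs over registers holding elements of O_K.  A program
   is a finite object, fixed before the input is known. *)
Inductive expr : Type :=
| Reg of nat
| Cst of quadint
| Add of expr & expr
| Sub of expr & expr
| Mul of expr & expr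
| Quo of expr & expr
| Sqrt of expr.

Inductive test : Type :=
| TestEq of expr & expr
| TestAbsLe of expr & expr.

Inductive cmd : Type :=
| Skip
| Assign of nat & expr
| Output of expr
| Seq of cmd & cmd
| If of test & cmd & cmd
| While of test & cmd.

Definition state := nat -> quadint.

Definition update (s : state) (i : nat) (v : quadint) : state :=
  fun j => if j == i then v else s j.

Fixpoint eval (s : state) (e : expr) : quadint :=
  match e with
  | Reg i => s i
  | Cst c => c
  | Add e1 e2 => eval s e1 + eval s e2
  | Sub e1 e2 => eval s e1 - eval s e2
  | Mul e1 e2 => eval s e1 * eval s e2
  | Quo e1 e2 => qquo (eval s e1) (eval s e2)
  | Sqrt e1 => qsqrt (eval s e1)
  end.

(* number of elementary operations *)
Fixpoint ops (e : expr) : nat :=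
  match e with
  | Reg _ | Cst _ => 0
  | Add e1 e2 | Sub e1 e2 | Mul e1 e2 | Quo e1 e2 => (ops e1 + ops e2).+1%N
  | Sqrt e1 => (ops e1).+1
  end.

Definition test_eval (s : state) (b : test) : bool :=
  match b with
  | TestEq e1 e2 => eval s e1 == eval s e2
  | TestAbsLe e1 e2 => qabs (eval s e1) <= qabs (eval s e2)
  end.

Definition test_ops (b : test) : nat :=
  match b with TestEq e1 e2 | TestAbsLe e1 e2 => (ops e1 + ops e2)%N end.

(* exec c s s' out t: c started in state s halts in state s', having output the
   elements of out, at cost t.  The cost charges one unit for each elementary
   operation and also one for each assignment, output and test, hence it bounds
   the number of elementary operations from above. *)
Inductive exec : cmd -> state -> state -> seq quadint -> nat -> Prop :=
| exec_skip s : exec Skip s s [::] 0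
| exec_assign s i e :
    exec (Assign i e) s (update s i (eval s e)) [::] (ops e).+1
| exec_output s e : exec (Output e) s s [:: eval s e] (ops e).+1
| exec_seq c1 c2 s1 s2 s3 out1 out2 t1 t2 :
    exec c1 s1 s2 out1 t1 -> exec c2 s2 s3 out2 t2 ->
    exec (Seq c1 c2) s1 s3 (out1 ++ out2) (t1 + t2)%N
| exec_if b c1 c2 s s' out t :
    exec (if test_eval s b then c1 else c2) s s' out t ->
    exec (If b c1 c2) s s' out (test_ops b + t).+1%N
| exec_while_false b c s :
    ~~ test_eval s b -> exec (While b c) s s [::] (test_ops b).+1
| exec_while_true b c s1 s2 s3 out1 out2 t1 t2 :
    test_eval s1 b -> exec c s1 s2 out1 t1 ->
    exec (While b c) s2 s3 out2 t2 ->
    exec (While b c) s1 s3 (out1 ++ out2) (test_ops b + t1 + t2).+1%N.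

(* inputs in registers 0, 1 and 2; all other registers are 0 *)
Definition input (N S r : quadint) : state :=
  fun i => match i with 0%N => N | 1%N => S | 2%N => r | _ => 0 end.

Definition runs (c : cmd) (N S r : quadint) (out : seq quadint) (t : nat) :
  Prop := exists s', exec c (input N S r) s' out t.

End RingOfIntegers.

(* Main.v *)
Require Import Defs.
From HB Require Import structures.
From mathcomp Require Import all_boot all_order all_algebra.
From mathcomp Require Import algC algnum.
From mathcomp Require Import complex zify ring lra.
From mathcomp Require Import boolp classical_sets reals exp.
Set Implicit Arguments.
Unset Strict Implicit.
Unset Printing Implicit Defensive.
Import Order.TTheory GRing.Theory Num.Theory.
Local Open Scope ring_scope.

(* Lenstra's algorithm for divisors in residue classes, over O_K.  Suppose
   N = D D' with D = S x + r, and let u be an inverse of r modulo S.  Then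
   S divides u D - 1, so D' (u D - 1)^2 = 0 modulo S^2, which reads
     (u^2 N) D + 1 D' = 2 u N  (mod S^2),   while   S D + 0 D' = S r  (mod S^2).
   Running Euclid's algorithm on the leading coefficients of these two relations
   yields relations a D + b D' = e (mod S^2), and |a_i b_(i+1)| = O(|S|), because
   the 2x2 determinants of consecutive rows have absolute value |S| and |a_i|
   decreases geometrically.  At the first row with |a| |D| <= |S|^2, the bound
   |D D'| = |N| < |S|^3 gives |b| |D'| = O(|S|^2), so a D + b D' is one of
   boundedly many elements congruent to e modulo S^2.  Knowing this value and
   D D' = N, one finds D by solving a quadratic equation.  If |S| > 2 |N|, only
   the least residue of r modulo S can be a divisor, so one may assume
   log |S| = O(log |N|), which bounds the number of Euclidean steps. *)

(** * Integrality of rational numbers *)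

Lemma integral_ratr_int (R : realType) (q : rat) :
  integralOver (intr : int -> R[i]) (ratr q) -> q \is a Num.int.
Proof.
move=> [p p_mon p_root].
have rp : root (map_poly (intr : int -> rat) p) q.
  rewrite -(fmorph_root (@ratr R[i])) -map_poly_comp.
  by rewrite (eq_map_poly (fun z => ratr_int R[i] z)).
(* The polynomial has integer coefficients, so its root [q] can be moved from [R[i]] to [algC],
   where rational algebraic integers are known to be integers. *)
have : (ratr q : algC) \is a Num.int.
  apply: Cint_rat_Aint; first exact: Crat_rat.
  apply: (@root_monic_Aint (map_poly (intr : int -> algC) p)).
  - rewrite -(eq_map_poly (fun z => ratr_int algC z)) map_poly_comp.
    by rewrite fmorph_root.
  - exact: monic_map.
  - by apply/polyOverP => i; rewrite coef_map /= intr_int.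
move=> /intrP[z hz]; apply/intrP; exists z.
by apply: (fmorph_inj (@ratr algC)); rewrite /= ratr_int.
Qed.

Lemma sqrtC_negint (R : realType) (d : int) : d < 0 ->
  exists2 y : R, sqrtC (d%:~R : R[i]) = Complex 0 y & y ^+ 2 = - d%:~R.
Proof.
move=> d0; have := sqrtCK (d%:~R : R[i]).
case: (sqrtC _) => x y; have -> : (d%:~R : R[i]) = Complex d%:~R 0.
  by rewrite -(rmorph_int (@real_complex R)).
rewrite expr2 => -[E1 E2].
have d0' : (d%:~R : R) < 0 by rewrite ltrz0.
have xy : x * y = 0 by lra.
move/eqP: xy; rewrite mulf_eq0 => /orP[/eqP x0|/eqP y0].
  by subst x; exists y => //; rewrite expr2; lra.
by subst y; have := sqr_ge0 x; rewrite expr2; lra.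
Qed.

(** If y = u / v in lowest terms, then v^2 divides d u^2, hence d; as each listed d is squarefree, v
    = 1. *)
Lemma sqrfree_rat_int (d : int) (y : rat) :
  d \in [:: -1; -2%:Z; -3%:Z; -7%:Z; -11%:Z] ->
  d%:~R * y ^+ 2 \is a Num.int -> y \is a Num.int.
Proof.
move=> hd /intrP[z hz].
have den0 : (denq y)%:~R != 0 :> rat by rewrite intr_eq0 denq_neq0.
have E : d * numq y ^+ 2 = z * denq y ^+ 2.
  have yE := divq_num_den y; apply/eqP; rewrite -(eqr_int rat) !intrM -hz.
  move: (numq y) (denq y) den0 yE => u v v0 <-.
  by apply/eqP; field.
have dv : (`|denq y| ^ 2 %| `|d|)%N.
  rewrite -(@Gauss_dvdl _ _ (`|numq y| ^ 2)).
    by rewrite -!abszX -!abszM E abszM dvdn_mull.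
  by rewrite coprime_pexpl // coprime_pexpr // coprime_sym coprime_num_den.
have den1 : `|denq y|%N = 1%N.
  have : (0 < `|denq y|)%N by rewrite absz_gt0 denq_neq0.
  move: dv; move: (`|denq y|)%N => m.
  (* From m = 4 on, m^2 >= 16 exceeds every |d|; smaller m are checked one by one. *)
  have [m3|m3] := leqP m 3; last first.
    move=> /dvdn_leq h _; exfalso.
    have : (16 <= m ^ 2)%N by rewrite (@leq_exp2r 4 m 2).
    by move: hd h; rewrite !inE => /or4P[||| /orP[]] /eqP ->;
      move=> /(_ isT) /[swap] /leq_trans/[apply].
  by move: m3 hd; case: m => [|[|[|[|[]]]]]//;
    rewrite !inE => _ /or4P[||| /orP[]] /eqP ->.
apply/intrP; exists (numq y); rewrite -[LHS]divq_num_den.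
have -> : denq y = 1 by rewrite -[denq y]gez0_abs ?denq_ge0 // den1.
by rewrite divr1.
Qed.

(** * Absolute values and Euclidean division *)

Section QuadInt.
Variables (R : realType) (d : int).
Hypothesis hd : d \in [:: -1; -2%:Z; -3%:Z; -7%:Z; -11%:Z].
Implicit Types x y z a b q : quadint R d.

Lemma qabsM x y : qabs (x * y) = qabs x * qabs y.
Proof. exact: Normc.normcM. Qed.

Lemma qabsD x y : qabs (x + y) <= qabs x + qabs y.
Proof. exact: le_normcD. Qed.

Lemma qabsN x : qabs (- x) = qabs x.
Proof. exact: normcN. Qed.

Lemma qabsB x y : qabs (x - y) <= qabs x + qabs y.
Proof. by rewrite -(qabsN y) qabsD. Qed.

Lemma qabs1 : qabs (1 : quadint R d) = 1.
Proof. exact: Normc.normc1. Qed.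

Lemma qabs0 : qabs (0 : quadint R d) = 0.
Proof. exact: Normc.normc0. Qed.

Lemma qabs_nat n : qabs (n%:R : quadint R d) = n%:R.
Proof.
rewrite /qabs [quadval _](raddfMn val n (1 : quadint R d)).
by rewrite [LHS]normcMn Normc.normc1.
Qed.

Lemma qabs_ge0 x : 0 <= qabs x.
Proof. by rewrite /qabs; case: (quadval x) => u v; rewrite sqrtr_ge0. Qed.

Lemma qabs_eq0 x : (qabs x == 0) = (x == 0).
Proof.
apply/eqP/eqP => [|->]; last exact: qabs0.
by move/Normc.eq0_normc => h; apply: val_inj.
Qed.

Lemma qmulf_eq0 x y : (x * y == 0) = (x == 0) || (y == 0).
Proof. by rewrite -!qabs_eq0 qabsM mulf_eq0. Qed.

Lemma qmulfI x : x != 0 -> injective ( *%R x).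
Proof.
move=> x0 y z h; apply/eqP; rewrite -subr_eq0.
have := qmulf_eq0 x (y - z); rewrite (negbTE x0) /= => <-.
by rewrite mulrBr h subrr.
Qed.

Lemma d_lt0 : d < 0.
Proof. by move: hd; rewrite !inE => /or4P[||| /orP[]] /eqP ->. Qed.

(** For x = a + b sqrt d, the trace 2a and the norm a^2 - d b^2 are integral and rational, hence
    integers. Then d (2b)^2 = (2a)^2 - 4 (a^2 - d b^2) is an integer, and so is 2b. The integrality
    of the norm |x|^2 gives |x| >= 1 for nonzero x. *)
Lemma quadint_coords x : exists m n : int,
  [/\ quadval x *+ 2 = m%:~R + n%:~R * sqrtC d%:~R,
      qabs x ^+ 2 *+ 4 = m%:~R ^+ 2 - d%:~R * n%:~R ^+ 2
    & exists k : int, qabs x ^+ 2 = k%:~R].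
Proof.
have [y sqrtdE y2] := @sqrtC_negint R d d_lt0.
case: x => z hz /=; have /asboolP[[a [b zE]] zint] := hz.
have conjint : integralOver (intr : int -> R[i]) (conjc z).
  have := integral_rmorph (@conjc R) zint.
  move=> [p pm pr]; exists p => //.
  by rewrite (eq_map_poly (g := conjc \o intr)) // => i /=; rewrite rmorph_int.
have ratrE (c : rat) : ratr c = Complex (ratr c) 0 :> R[i].
  by rewrite -(fmorph_eq_rat (real_complex R \o ratr)).
have zE' : z = Complex (ratr a) (ratr b * y).
  rewrite zE sqrtdE !ratrE.
  by apply/eqP; rewrite eq_complex /= !mul0r !mulr0 !subr0 !add0r !addr0 !eqxx.
have tr : a *+ 2 \is a Num.int.
  apply: (@integral_ratr_int R).
  have -> : ratr (a *+ 2) = z + conjc z :> R[i].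
    rewrite zE' ratrE.
    by apply/eqP; rewrite eq_complex /= subrr rmorphMn /= mulr2n !eqxx.
  exact: integral_add.
have nm : a ^+ 2 - d%:~R * b ^+ 2 \is a Num.int.
  apply: (@integral_ratr_int R).
  have -> : ratr (a ^+ 2 - d%:~R * b ^+ 2) = z * conjc z :> R[i].
    rewrite zE' ratrE.
    rewrite rmorphB rmorphM !rmorphXn /= ratr_int.
    apply/eqP; rewrite eq_complex /= -[d%:~R]opprK -y2.
    by apply/andP; split; apply/eqP; ring.
  exact: integral_mul.
have sq : b *+ 2 \is a Num.int.
  apply: (sqrfree_rat_int hd).
  have -> : d%:~R * (b *+ 2) ^+ 2 =
     (a *+ 2) ^+ 2 - 4 * (a ^+ 2 - d%:~R * b ^+ 2) by ring.
  by rewrite rpredB ?rpredX ?rpredM // rpred_nat.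
have /intrP[m mE] := tr; have /intrP[n nE] := sq; have /intrP[k kE] := nm.
have ratrz (c : rat) (i : int) (K : numFieldType) :
    c *+ 2 = i%:~R -> i%:~R = ratr c *+ 2 :> K.
  by move=> cE; rewrite -(ratr_int K i) -cE raddfMn.
have nE' : qabs (QuadInt hz) ^+ 2 = ratr a ^+ 2 - d%:~R * ratr b ^+ 2.
  rewrite /qabs /= zE' /Normc.normc sqr_sqrtr ?addr_ge0 ?sqr_ge0 //.
  by rewrite [(_ * y) ^+ 2]exprMn y2; ring.
exists m, n; split.
- rewrite (ratrz a m) // (ratrz b n) // zE.
  by move: (ratr a) (ratr b) => u v; ring.
- rewrite (ratrz a m) // (ratrz b n) // nE'.
  by move: (ratr a) (ratr b) => u v; ring.
- exists k; rewrite nE'.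
  by rewrite -(ratr_int R k) -kE rmorphB rmorphM !rmorphXn /= ratr_int.
Qed.

Lemma qabs_ge1 x : x != 0 -> 1 <= qabs x.
Proof.
move=> x0; have [m [n [_ _ [k hk]]]] := quadint_coords x.
have : 0 < qabs x ^+ 2 by rewrite exprn_gt0 // lt_def qabs_eq0 x0 qabs_ge0.
rewrite hk ltr0z => k0; rewrite -(@expr_ge1 _ 2) ?qabs_ge0 // hk.
by rewrite ler1z -gtz0_ge1.
Qed.

Lemma quadint_coords_bound x : exists m n : int,
  [/\ quadval x *+ 2 = m%:~R + n%:~R * sqrtC d%:~R,
      `|m|%:R <= 2 * qabs x & `|n|%:R <= 2 * qabs x].
Proof.
have [m [n [xE nE _]]] := quadint_coords x; exists m, n; split=> //.
all: rewrite -[leLHS]ger0_norm // -[leRHS]ger0_norm ?mulr_ge0 ?qabs_ge0 //.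
all: rewrite -ler_sqr ?nnegrE // ?normr_ge0 // !real_normK ?num_real //.
all: rewrite natr_absz intr_norm real_normK ?num_real //.
all: have d1 : (d%:~R : R) <= -1
  by rewrite -[-1]/((-1)%:~R) ler_int; move: d_lt0; lia.
all: have := sqr_ge0 (m%:~R : R); have := sqr_ge0 (n%:~R : R); nra.
Qed.

Lemma quadint_finite (B : R) : exists l : seq (quadint R d),
  forall x, qabs x <= B -> x \in l.
Proof.
have [K hK] : exists K : nat, 2 * B < K%:R.
  by exists (Num.truncn (2 * B)).+1; exact: truncnS_gt.
pose rng := [seq Posz i | i <- iota 0 K] ++ [seq Negz i | i <- iota 0 K].
have rngP (m : int) x : qabs x <= B -> `|m|%:R <= 2 * qabs x -> m \in rng.
  move=> hx hm; have : (`|m| < K)%N.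
    by rewrite -(ltr_nat R) (le_lt_trans hm) // (le_lt_trans _ hK) // ler_pM2l.
  rewrite mem_cat; case: m {hm} => i /= iK; apply/orP; [left|right];
    by rewrite map_f // mem_iota //= ltnW.
(* Pairs (m, n) whose half-sum is not in O_K are sent to the default 0, which does no harm. *)
exists [seq insubd 0 ((m%:~R + n%:~R * sqrtC d%:~R) / 2) | m <- rng, n <- rng].
move=> x hx; have [m [n [xE hm hn]]] := quadint_coords_bound x.
apply/allpairsP; exists (m, n); split=> /=; try exact: (rngP _ x).
rewrite -xE; apply: val_inj.
rewrite -[quadval x *+ 2]mulr_natr mulfK ?pnatr_eq0 //.
by rewrite -[quadval x]/(val x) valKd.
Qed.

(** * Covering of the complex plane by O_K *)

Lemma quadint_predP (a b : rat) (s t : int) (z : R[i]) :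
  z = ratr a + ratr b * sqrtC d%:~R -> z ^+ 2 = t%:~R * z + s%:~R ->
  quadint_pred d z.
Proof.
move=> zE z2; apply/asboolP; split; first by exists a, b.
exists ('X^2 - (t *: 'X + s%:P)).
  rewrite monicE lead_coefDl ?lead_coefXn // size_polyN size_polyXn.
  rewrite ltnS (leq_trans (size_polyD _ _)) // geq_max.
  rewrite (leq_trans (size_scale_leq _ _)) ?size_polyX //.
  by rewrite (leq_trans (size_polyC_leq1 _)).
rewrite rootE rmorphB rmorphD /= map_polyXn map_polyZ map_polyX map_polyC /=.
by rewrite !hornerE z2 subrr.
Qed.

Lemma sqrtC_quadint : quadint_pred d (sqrtC d%:~R : R[i]).
Proof.
apply: (@quadint_predP 0 1 d 0); first by rewrite rmorph0 rmorph1; ring.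
by rewrite sqrtCK mul0r add0r.
Qed.

Lemma near_int (u c : R) : c != 0 ->
  exists n : int, (u - n%:~R * c) ^+ 2 <= c ^+ 2 / 4.
Proof.
move=> c0; pose v := u / c; exists (Num.floor (v + 2^-1)).
have -> : u = v * c by rewrite divfK.
rewrite -mulrBl exprMn mulrC ler_wpM2l ?sqr_ge0 //.
have := floor_le (v + 2^-1); have := floorD1_gt (v + 2^-1).
rewrite intrD; set w := _%:~R => h1 h2; nra.
Qed.

(* t = sqrt d for d = -1, -2, and t = (1 + sqrt d) / 2 otherwise. *)
Lemma quadint_theta : exists t : quadint R d,
  complex.Im (quadval t) != 0 /\ complex.Im (quadval t) ^+ 2 <= 11 / 4.
Proof.
have [y yE y2] := @sqrtC_negint R d d_lt0.
have y0 : y != 0.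
  by rewrite -sqrf_eq0 y2 oppr_eq0 intr_eq0 lt_eqF // d_lt0.
have sq : sqrtC d%:~R ^+ 2 = d%:~R :> R[i] by rewrite sqrtCK.
have [dE|dE] : d \in [:: -1; -2%:Z] \/ d \in [:: -3%:Z; -7%:Z; -11%:Z].
  by move: hd; rewrite !inE => /or4P[||| /orP[]] /eqP ->; auto.
  exists (QuadInt sqrtC_quadint) => /=; rewrite yE /=; split=> //; rewrite y2.
  by move: dE; rewrite !inE => /orP[] /eqP ->; rewrite -mulrNz /=; lra.
(* Since d = 1 modulo 4, (1 + sqrt d) / 2 is a root of X^2 - X + k. *)
have [k kE] : exists k : int, d = 1 - 4 * k.
  by move: dE; rewrite !inE => /or3P[] /eqP ->; [exists 1|exists 2|exists 3].
have P : quadint_pred d ((1 + sqrtC d%:~R) / 2 : R[i]).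
  apply: (@quadint_predP 2^-1 2^-1 (- k) 1).
    by rewrite fmorphV rmorph_nat; field.
  rewrite expr_div_n sqrrD sq {2}kE; rewrite !rmorphE /= ?intrM; by field.
have wE : (1 + sqrtC d%:~R) / 2 = Complex 2^-1 (y / 2) :> R[i].
  apply: (canLR (mulfK _)); first by rewrite pnatr_eq0.
  rewrite yE -(rmorph_nat (real_complex R)) /=.
  by apply/eqP; rewrite eq_complex /=; apply/andP; split; apply/eqP; field.
exists (QuadInt P) => /=; rewrite wE /=; split.
  by rewrite mulf_neq0 ?invr_eq0 ?pnatr_eq0.
rewrite expr_div_n y2.
by move: dE; rewrite !inE => /or3P[] /eqP ->; rewrite -mulrNz /=; lra.
Qed.

(* A lattice with basis 1, t and (Im t)^2 <= 11/4 has covering radius at most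
   sqrt (1/4 + 11/16) = sqrt (15/16) < 31/32. *)
Lemma quadint_cover (z : R[i]) :
  exists q, Normc.normc (z - quadval q) <= 31 / 32.
Proof.
have [t [t0 tle]] := quadint_theta.
case: z => u v; have [n hn] := near_int v t0.
have [m hm] := near_int (u - n%:~R * complex.Re (quadval t)) (oner_neq0 R).
exists (m%:~R + n%:~R * t).
have -> : quadval (m%:~R + n%:~R * t) =
    Complex (m%:~R + n%:~R * complex.Re (quadval t))
            (n%:~R * complex.Im (quadval t)).
  rewrite -[quadval _]/(val _) rmorphD rmorphM !rmorph_int /=.
  rewrite -!(rmorph_int (real_complex R)) /=.
  case: (quadval t) => a b /=.
  by apply/eqP; rewrite eq_complex /=; apply/andP; split; apply/eqP; ring.
rewrite /Normc.normc /=.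
rewrite -[leRHS]ger0_norm ?divr_ge0 // -sqrtr_sqr ler_wsqrtr //.
move: hn hm tle; set p := complex.Re _; set h := complex.Im _ => hn hm tle.
have -> : u - (m%:~R + n%:~R * p) = u - n%:~R * p - m%:~R * 1 by ring.
move: ((v - _) ^+ 2) ((u - _ - _) ^+ 2) (h ^+ 2) hn hm tle => A B C *; lra.
Qed.

(** The minimum defining [qquo] is attained: a q with |q| > 2 |a| / |b| does worse than q = 0, and
    only finitely many q remain. *)
Lemma qquo_min a b q' :
  b != 0 -> qabs (a - b * qquo a b) <= qabs (a - b * q').
Proof.
move=> b0; rewrite /qquo (negbTE b0).
set P := (X in xget 0 X); suff : P (xget 0 P) by exact.
apply: xgetPex; rewrite /P.
have b_gt0 : 0 < qabs b by rewrite lt_def qabs_eq0 b0 qabs_ge0.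
have [l lP] := quadint_finite (2 * qabs a / qabs b).
have l0 : 0 \in l by rewrite lP // qabs0 divr_ge0 ?mulr_ge0 ?qabs_ge0.
pose F (i : 'I_(size l)) := qabs (a - b * l`_i).
have s0 : (0 < size l)%N by case: (l) l0.
pose i0 := [arg min_(i < Ordinal s0 | true) F i]%O.
have Fmin j : F i0 <= F j by rewrite /i0; case: arg_minP => // i _; apply.
have lmin q : q \in l -> F i0 <= qabs (a - b * q).
  move=> ql; have := ql; rewrite -index_mem => hi.
  by have := Fmin (Ordinal hi); rewrite /F /= nth_index.
exists l`_i0 => q; have [hq|hq] := leP (qabs q) (2 * qabs a / qabs b).
  by apply: lmin; exact: lP.
apply: (le_trans (lmin _ l0)); rewrite mulr0 subr0.
move: hq; rewrite ltr_pdivrMr // [qabs q * _]mulrC -qabsM => hq.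
have := qabsB a (a - b * q).
have -> : a - (a - b * q) = b * q by ring.
lra.
Qed.

Lemma qquo_rem a b : b != 0 -> qabs (a - b * qquo a b) <= 31 / 32 * qabs b.
Proof.
move=> b0; have [q hq] := quadint_cover (quadval a / quadval b).
apply: (le_trans (qquo_min a q b0)).
have vb0 : quadval b != 0.
  by apply: contra b0 => /eqP h; apply/eqP/val_inj.
have E : qabs (a - b * q) =
    qabs b * Normc.normc (quadval a / quadval b - quadval q).
  rewrite -Normc.normcM mulrBr mulrCA mulfV // mulr1.
  by rewrite -[LHS]/(Normc.normc (val (a - b * q))) rmorphB rmorphM.
by rewrite E mulrC ler_wpM2r // qabs_ge0.
Qed.

(** The remainder 0 is possible, so the least remainder is 0. Exact division is thus available to
    programs. *)
Lemma qquoK b q : b != 0 -> qquo (b * q) b = q.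
Proof.
move=> b0; apply: (qmulfI b0); apply/esym/eqP; rewrite -subr_eq0 -qabs_eq0.
have := qquo_min (b * q) q b0; rewrite subrr qabs0 => h.
by rewrite eq_le h qabs_ge0.
Qed.

Lemma qsqrt_sqr (w : quadint R d) : qsqrt (w ^+ 2) = w \/ qsqrt (w ^+ 2) = - w.
Proof.
have /eqP : qsqrt (w ^+ 2) ^+ 2 = w ^+ 2.
  rewrite /qsqrt; set P := (X in xget 0 X); suff : P (xget 0 P) by exact.
  by apply: xgetPex; exists w.
rewrite -subr_eq0 subr_sqr qmulf_eq0 subr_eq0 addr_eq0.
by case/orP => /eqP ->; [left|right].
Qed.

(** The signs are split off because the search loops count through natural numbers only. *)
Lemma quadint_doubleP : exists w : quadint R d, forall x, exists m n : nat,
  [/\ m%:R <= 2 * qabs x, n%:R <= 2 * qabs x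
    & x *+ 2 \in [:: m%:R + n%:R * w; m%:R - n%:R * w;
                     - m%:R + n%:R * w; - m%:R - n%:R * w]].
Proof.
exists (QuadInt sqrtC_quadint) => x.
have [m [n [xE hm hn]]] := quadint_coords_bound x.
exists `|m|%N, `|n|%N; split=> //.
have -> : x *+ 2 = m%:~R + n%:~R * QuadInt sqrtC_quadint.
  by apply: val_inj; rewrite rmorphMn rmorphD rmorphM !rmorph_int.
have intE (i : int) : i%:~R = `|i|%N%:R :> quadint R d \/
    i%:~R = - `|i|%N%:R :> quadint R d.
  by case: i => i; [left|right] => //=; rewrite NegzE mulrNz.
by case: (intE m) => ->; case: (intE n) => ->;
   rewrite !inE ?mulNr eqxx ?orbT.
Qed.

End QuadInt.

(** * Programs *)

Section Programs.
Variables (R : realType) (d : int).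
Hypothesis hd : d \in [:: -1; -2%:Z; -3%:Z; -7%:Z; -11%:Z].
Local Notation Q := (quadint R d).
Local Notation reg := (Reg R d).
Implicit Types (s : state R d) (e : expr R d) (es : seq (expr R d)).
Implicit Types (N S r D : Q).

Definition target N S r D := qdvd D N /\ exists x, D = S * x + r.

Definition inputs s := (s 0%N, s 1%N, s 2%N).

(** Every output passes these two tests, so soundness never depends on how a candidate was found. *)
Definition try e : cmd R d :=
  If (TestEq (Mul e (Quo (reg 0) e)) (reg 0))
    (If (TestEq (Mul (reg 1) (Quo (Defs.Sub e (reg 2)) (reg 1)))
                (Defs.Sub e (reg 2)))
      (Output e) (Skip R d))
    (Skip R d).

Definition tries es := foldr (fun e c => Seq (try e) c) (Skip R d) es.

Lemma qdvd_quo N D : N != 0 -> reflect (qdvd D N) (D * qquo N D == N).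
Proof.
move=> N0; apply: (iffP eqP) => [<-|[c cE]].
  by exists (qquo N D); rewrite mulrC.
have D0 : D != 0 by apply: contraNneq N0 => D0; rewrite cE D0 mulr0.
by rewrite cE (mulrC c) qquoK.
Qed.

Lemma residue_quo S r D :
  reflect (exists x, D = S * x + r) (S * qquo (D - r) S == D - r).
Proof.
apply: (iffP eqP) => [h|[x ->]].
  by exists (qquo (D - r) S); rewrite h subrK.
rewrite addrK; have [->|S0] := eqVneq S 0; first by rewrite !mul0r.
by rewrite qquoK.
Qed.

Lemma try_exec e : exists K : nat, forall s N S r,
  inputs s = (N, S, r) -> N != 0 -> exists out t,
  [/\ exec (try e) s s out t, (t <= K)%N &
      forall D, D \in out <-> D = eval s e /\ target N S r D].
Proof.
pose T1 := TestEq (Mul e (Quo (reg 0) e)) (reg 0).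
pose T2 :=
  TestEq (Mul (reg 1) (Quo (Defs.Sub e (reg 2)) (reg 1))) (Defs.Sub e (reg 2)).
exists (test_ops T1 + (test_ops T2 + (ops e).+1).+1).+1%N.
move=> s N S r [sN sS sr] N0.
have [dv|ndv] := boolP (test_eval s T1); last first.
  exists [::], (test_ops T1 + 0).+1; split.
  - by apply: exec_if; rewrite (negbTE ndv); exact: exec_skip.
  - by rewrite ltnS leq_add2l.
  - move=> D; split=> // -[-> [/(qdvd_quo _ N0) dv _]].
    by move: ndv; rewrite /= sN dv.
have [rs|nrs] := boolP (test_eval s T2).
  exists [:: eval s e], (test_ops T1 + (test_ops T2 + (ops e).+1).+1).+1%N.
  split=> //.
  - by apply: exec_if; rewrite dv; apply: exec_if; rewrite rs; exact: exec_output.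
  - move=> D; rewrite inE; split=> [/eqP ->|[-> //]]; split=> //; split.
      by apply/(qdvd_quo _ N0); move: dv; rewrite /= sN.
    by apply/residue_quo; move: rs; rewrite /= sS sr.
exists [::], (test_ops T1 + (test_ops T2 + 0).+1).+1%N; split.
- apply: exec_if; rewrite dv; apply: exec_if; rewrite (negbTE nrs).
  exact: exec_skip.
- by lia.
- move=> D; split=> // -[-> [_ /residue_quo rs]].
  by move: nrs; rewrite /= sS sr rs.
Qed.

(** The candidate list belongs to the program, so [K] is fixed before the input and one pass costs
    O(1). *)
Lemma tries_exec es : exists K : nat, forall s N S r,
  inputs s = (N, S, r) -> N != 0 -> exists out t,
  [/\ exec (tries es) s s out t, (t <= K)%N &
      forall D, D \in out <-> D \in map (eval s) es /\ target N S r D].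
Proof.
elim: es => [|e es [K IH]].
  exists 0%N => s N S r _ _; exists [::], 0%N; split=> //; first exact: exec_skip.
  by move=> D; split=> // -[].
have [K' he] := try_exec e.
exists (K' + K)%N => s N S r sE N0.
have [out1 [t1 [ex1 le1 o1]]] := he s N S r sE N0.
have [out2 [t2 [ex2 le2 o2]]] := IH s N S r sE N0.
exists (out1 ++ out2), (t1 + t2)%N; split; first exact: exec_seq ex1 ex2.
  exact: leq_add.
move=> D; rewrite mem_cat /= inE; split.
  by case/orP => [/o1[-> ?]|/o2[-> ?]]; rewrite ?eqxx ?orbT.
by case=> /orP[/eqP DE|De] tD; apply/orP; [left; apply/o1|right; apply/o2].
Qed.

(** * Straight-line code and loops *)

Definition assigns (l : seq (nat * expr R d)) :=
  foldr (fun a c => Seq (Assign a.1 a.2) c) (Skip R d) l.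

Definition run_assigns (l : seq (nat * expr R d)) s :=
  foldl (fun s a => update s a.1 (eval s a.2)) s l.

Lemma assigns_exec l : exists K : nat, forall s,
  exec (assigns l) s (run_assigns l s) [::] K.
Proof.
elim: l => [|[i e] l [K IH]]; first by exists 0%N => s; exact: exec_skip.
exists ((ops e).+1 + K)%N => s /=.
exact: (exec_seq (exec_assign s i e) (IH _)).
Qed.

(** The body acts on the visited states as the function [f], which turns the loop into an iterate of
    [f]. The factor [n.+1] makes room for the final, failing test. *)
Lemma while_exec b c (f : state R d -> state R d) (O : state R d -> Q -> Prop)
    (K n : nat) s :
  (forall i, (i < n)%N -> test_eval (iter i f s) b) ->
  ~~ test_eval (iter n f s) b ->
  (forall i, (i < n)%N -> exists out t,
    [/\ exec c (iter i f s) (iter i.+1 f s) out t, (t <= K)%N &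
        forall D, D \in out <-> O (iter i.+1 f s) D]) ->
  exists out t, [/\ exec (While b c) s (iter n f s) out t,
    (t <= (test_ops b + K).+1 * n.+1)%N &
    forall D, D \in out <-> exists2 i, (i < n)%N & O (iter i.+1 f s) D].
Proof.
elim: n s => [|n IH] s hb nb hc.
  exists [::], (test_ops b).+1; split; first exact: exec_while_false.
    by rewrite muln1 ltnS leq_addr.
  by move=> D; split=> // -[].
have iterE i : iter i f (f s) = iter i.+1 f s by rewrite iterSr.
have [||i hi|out2 [t2 [ex2 le2 o2]]] := IH (f s).
- by move=> i hi; rewrite iterE; exact: hb.
- by rewrite iterE.
- by rewrite !iterE; exact: (hc i.+1).
have [out1 [t1 [ex1 le1 o1]]] := hc 0%N isT.
exists (out1 ++ out2), (test_ops b + t1 + t2).+1; split.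
- by rewrite -iterE; exact: (exec_while_true (hb 0%N isT) ex1 ex2).
- by rewrite mulnS -addSn leq_add // ltnS leq_add2l.
move=> D; rewrite mem_cat; split.
  case/orP => [/o1 h|/o2[i hi h]]; first by exists 0%N.
  by exists i.+1 => //; move: h; rewrite iterE.
case=> -[|i] hi h; apply/orP; first by left; apply/o1.
by right; apply/o2; exists i; rewrite ?iterE.
Qed.

Definition for_loop (i : nat) e (c : cmd R d) :=
  While (TestAbsLe (reg i) e) (Seq c (Assign i (Add (reg i) (Cst 1)))).

(** No cost is tracked: these loops serve only the exhaustive search, which runs where no time bound
    is claimed. The invariant [P] must survive writes to the counter and fix the absolute value of
    the bound. *)
Lemma for_exec (P : state R d -> Prop) (O : nat -> Q -> Prop) (i : nat) e
    (c : cmd R d) (B : R) s :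
  (forall s, P s -> qabs (eval s e) = B) ->
  (forall s v, P s -> P (update s i v)) ->
  (forall s n, P s -> s i = n%:R -> exists s' out t,
    [/\ exec c s s' out t, P s', s' i = n%:R &
        forall D, D \in out <-> O n D]) ->
  P s -> s i = 0 -> exists s' out t,
    [/\ exec (for_loop i e c) s s' out t, P s' &
        forall D, D \in out <-> exists2 n, n%:R <= B & O n D].
Proof.
move=> hB hu hc Ps s0.
(* Induction on [m], which bounds the number of remaining passes when the counter is [k]. *)
suff gen m k s1 : P s1 -> s1 i = k%:R -> B < (k + m)%:R -> exists s' out t,
    [/\ exec (for_loop i e c) s1 s' out t, P s' &
        forall D, D \in out <-> exists n, [/\ (k <= n)%N, n%:R <= B & O n D]].
  have [|s' [out [t [ex Ps' o]]]] :=
    gen (Num.truncn B).+1 0%N s Ps s0; first exact: truncnS_gt.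
  exists s', out, t; split=> // D; split=> [/o[n [_ ? ?]]|[n ? ?]].
    by exists n.
  by apply/o; exists n.
elim: m k s1 => [|m IH] k {s0} s {}Ps sk hk.
  exists s, [::], (test_ops (TestAbsLe (reg i) e)).+1; split=> //.
    apply: exec_while_false.
    by rewrite /= sk (hB s Ps) qabs_nat -ltNge -(addn0 k).
  move=> D; split=> // -[n [kn nB _]]; move: hk.
  by rewrite addn0 => /(le_lt_trans nB); rewrite ltr_nat ltnNge kn.
have [kB|Bk] := leP k%:R B; last first.
  exists s, [::], (test_ops (TestAbsLe (reg i) e)).+1; split=> //.
    by apply: exec_while_false; rewrite /= sk (hB s Ps) qabs_nat -ltNge.
  move=> D; split=> // -[n [kn nB _]].
  by move: (le_lt_trans nB Bk); rewrite ltr_nat ltnNge kn.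
have [s1 [out1 [t1 [ex1 Ps1 s1k o1]]]] := hc s k Ps sk.
have [|||s2 [out2 [t2 [ex2 Ps2 o2]]]] :=
    IH k.+1 (update s1 i (eval s1 (Add (reg i) (Cst 1)))).
- exact: hu.
- by rewrite /update eqxx /= s1k -natr1.
- by rewrite addSnnS.
exists s2, ((out1 ++ [::]) ++ out2); eexists; split; last 1 first.
- move=> D; rewrite cats0 mem_cat; split.
    case/orP => [/o1 h|/o2[n [kn nB h]]]; first by exists k.
    by exists n; rewrite ltnW.
  move=> [n [kn nB h]]; apply/orP; have [E|nk] := eqVneq n k.
    by left; apply/o1; rewrite -E.
  by right; apply/o2; exists n; rewrite ltn_neqAle eq_sym nk.
- apply: exec_while_true ex2; first by rewrite /= sk (hB s Ps) qabs_nat.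
  exact: exec_seq ex1 (exec_assign _ _ _).
- exact: Ps2.
Qed.

(** * Exhaustive search *)

Lemma qdvd_qabs N D : N != 0 -> qdvd D N -> qabs D <= qabs N.
Proof.
move=> N0 [c cE]; rewrite cE qabsM ler_peMl ?qabs_ge0 // qabs_ge1 //.
by apply: contraNneq N0 => c0; rewrite cE c0 mul0r.
Qed.

(* 2 O_K is contained in Z[sqrt d]: each D is half of some +-m +- n w, with
   w = sqrt d. *)
Definition brute_candidates (w : Q) : seq (expr R d) :=
  let mw := Mul (reg 4) (Cst w) in
  let neg e := Defs.Sub (Cst 0) e in
  let half e := Quo e (Cst 2) in
  [:: half (Add (reg 3) mw); half (Defs.Sub (reg 3) mw);
      half (Add (neg (reg 3)) mw); half (Defs.Sub (neg (reg 3)) mw)].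

(** The coordinates of 2 D are at most 2 |D| <= 2 |N|, within this bound. *)
Definition brute_bound : expr R d := Mul (Cst 4) (reg 0).

Definition brute_row (w : Q) : cmd R d :=
  Seq (Assign 4 (Cst 0)) (for_loop 4 brute_bound (tries (brute_candidates w))).

Definition brute (w : Q) : cmd R d := for_loop 3 brute_bound (brute_row w).

Lemma brute_exec : exists w, forall N S r, N != 0 -> exists s' out t,
  exec (brute w) (input N S r) s' out t /\
  forall D, D \in out <-> target N S r D.
Proof.
have [w wP] := @quadint_doubleP R d hd; exists w => N S r N0.
have [K tryP] := tries_exec (brute_candidates w).
have bE s : inputs s = (N, S, r) -> qabs (eval s brute_bound) = 4 * qabs N.
  by case=> /= -> _ _; rewrite qabsM (qabs_nat _ _ 4).
pose O (m n : nat) D :=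
  D \in [:: qquo (m%:R + n%:R * w) 2; qquo (m%:R - n%:R * w) 2;
   qquo (0 - m%:R + n%:R * w) 2; qquo (0 - m%:R - n%:R * w) 2] /\ target N S r D.
have [//|//|s m sE sm|//|//|s' [out [t [ex _ o]]]] :=
  @for_exec (fun s => inputs s = (N, S, r))
   (fun m D => exists2 n : nat, n%:R <= 4 * qabs N & O m n D) 3
   brute_bound (brute_row w) (4 * qabs N) (input N S r).
- have [s1 [s1E _]|//|s1 n [s1E s1m] s1n|//|//|s' [out [t [ex [s'E s'm] o]]]] :=
   @for_exec (fun s => inputs s = (N, S, r) /\ s 3%N = m%:R) (O m)
   4 brute_bound (tries (brute_candidates w)) (4 * qabs N) (update s 4 0).
  + exact: bE.
  + have [out [t [ex _ o]]] := tryP s1 N S r s1E N0.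
    exists s1, out, t; split; [exact: ex|by []|exact: s1n|move=> D].
    by rewrite o /O /= s1m s1n.
  + exists s', ([::] ++ out), (1 + t)%N; split; [|exact: s'E|exact: s'm|exact: o].
    exact: exec_seq (exec_assign s 4 (Cst 0)) ex.
exists s', out, t; split; first exact: ex.
move=> D; split=> [/o[m _ [n _ [_ //]]]|tD]; apply/o.
have [m [n [hm hn DE]]] := wP D.
have DN := qdvd_qabs N0 tD.1; have := qabs_ge0 N => N_ge0.
exists m; first by lra.
exists n; first by lra.
split=> //; have two0 : (2 : Q) != 0.
  by rewrite -(qabs_eq0 (2 : Q)) qabs_nat pnatr_eq0.
have -> : D = qquo (D *+ 2) 2 by rewrite -[D *+ 2]mulr_natl qquoK.
rewrite !sub0r !inE; move: DE; rewrite !inE => /or4P[] /eqP ->; apply/or4P.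
- by apply: Or41; exact: eqxx.
- by apply: Or42; exact: eqxx.
- by apply: Or43; exact: eqxx.
- by apply: Or44; exact: eqxx.
Qed.
End Programs.

(** * The algorithm *)

Section Lenstra.
Variables (R : realType) (d : int).
Hypothesis hd : d \in [:: -1; -2%:Z; -3%:Z; -7%:Z; -11%:Z].
Local Notation Q := (quadint R d).
Local Notation reg := (Reg R d).
Implicit Types (s : state R d) (e : expr R d) (es : seq (expr R d)).
Implicit Types (N S r D : Q).

(* Registers 3-5 and 6-8 hold the previous and the current row (a, b, e);
   registers 9 and 10 are scratch. *)
Definition euclid_code : seq (nat * expr R d) :=
  [:: (9, Quo (reg 3) (reg 6));
      (10, Defs.Sub (reg 3) (Mul (reg 9) (reg 6))); (3, reg 6); (6, reg 10);
      (10, Defs.Sub (reg 4) (Mul (reg 9) (reg 7))); (4, reg 7); (7, reg 10);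
      (10, Defs.Sub (reg 5) (Mul (reg 9) (reg 8))); (5, reg 8); (8, reg 10)]%N.

Definition euclid := run_assigns euclid_code.

Lemma euclidE s : let q := qquo (s 3%N) (s 6%N) in
  [/\ inputs (euclid s) = inputs s,
      [/\ euclid s 3%N = s 6%N, euclid s 4%N = s 7%N & euclid s 5%N = s 8%N] &
      [/\ euclid s 6%N = s 3%N - q * s 6%N, euclid s 7%N = s 4%N - q * s 7%N &
          euclid s 8%N = s 5%N - q * s 8%N]].
Proof. by []. Qed.

Lemma inputs_iter n s : inputs (iter n euclid s) = inputs s.
Proof. by elim: n => //= n <-; have [] := euclidE (iter n euclid s). Qed.

Lemma euclid_decr s : s 6%N != 0 ->
  qabs (euclid s 6%N) <= 31 / 32 * qabs (s 6%N).
Proof.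
by move=> s6; have [_ _ [-> _ _]] := euclidE s; rewrite mulrC qquo_rem.
Qed.

(** Each step shrinks the leading coefficient by 31/32, and a nonzero one has absolute value at
    least 1; so m steps without reaching 0 force (32/31)^m <= |s 6|. The extra 1 is the step that
    reaches 0. *)
Lemma euclid_length s : s 6%N != 0 -> exists n,
  [/\ iter n euclid s 6%N = 0, forall i, (i < n)%N -> iter i euclid s 6%N != 0 &
      n%:R <= 1 + ln (qabs (s 6%N)) / ln (32 / 31)].
Proof.
move=> s6; set L := ln _ / _.
have long m : (forall i, (i <= m)%N -> iter i euclid s 6%N != 0) -> m%:R <= L.
  move=> hm; have decr i : (i <= m)%N ->
      (32 / 31) ^+ i * qabs (iter i euclid s 6%N) <= qabs (s 6%N).
    elim: i => [|i IH] im; first by rewrite expr0 mul1r.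
    apply: le_trans (IH (ltnW im)); rewrite exprSr -mulrA.
    rewrite ler_wpM2l ?exprn_ge0 ?divr_ge0 //=.
    have := euclid_decr (hm i (ltnW im)); lra.
  have : (32 / 31) ^+ m <= qabs (s 6%N).
    apply: le_trans (decr m (leqnn m)); rewrite ler_peMr ?exprn_ge0 ?divr_ge0 //.
    by apply: qabs_ge1 => //; exact: hm.
  rewrite -ler_ln ?posrE ?exprn_gt0 ?divr_gt0 //; last first.
    by rewrite lt_def qabs_eq0 s6 qabs_ge0.
  rewrite lnXn ?divr_gt0 // -[ln _ *+ m]mulr_natl -ler_pdivlMr //.
  by apply: ln_gt0; lra.
have ex0 : exists n, iter n euclid s 6%N == 0.
  apply: contrapT => /forallNP none.
  have := long (Num.truncn L).+1 (fun i _ => introT negP (none i)).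
  by rewrite leNgt truncnS_gt.
case: (ex_minnP ex0) => -[|n] /eqP n0 nmin.
  by rewrite (n0 : s 6%N = 0) eqxx in s6.
have nz i : (i < n.+1)%N -> iter i euclid s 6%N != 0.
  by move=> hi; apply: contraL hi => /nmin; rewrite -leqNgt.
exists n.+1; split=> //; rewrite -nat1r lerD2l; exact: long.
Qed.

(** The test means that register 6 is nonzero, since nonzero elements of O_K have absolute value at
    least 1. *)
Definition euclid_loop es : cmd R d :=
  While (TestAbsLe (Cst 1) (reg 6)) (Seq (assigns euclid_code) (tries es)).

Lemma euclid_loop_exec es : exists K : nat, forall s N S r,
  inputs s = (N, S, r) -> N != 0 -> s 6%N != 0 -> exists n out t,
  [/\ iter n euclid s 6%N = 0, exec (euclid_loop es) s (iter n euclid s) out t,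
      t%:R <= K%:R * (2 + ln (qabs (s 6%N)) / ln (32 / 31)) &
      forall D, D \in out <-> exists2 i, (i < n)%N &
        D \in map (eval (iter i.+1 euclid s)) es /\ target N S r D].
Proof.
have [K1 h1] := assigns_exec euclid_code; have [K2 h2] := tries_exec hd es.
pose T := TestAbsLe (Cst 1) (reg 6).
exists (test_ops T + (K1 + K2)).+1 => s N S r sE N0 s6.
have [n [n0 nz nle]] := euclid_length s6.
have [|||out [t [ex le o]]] := @while_exec _ _ T
   (Seq (assigns euclid_code) (tries es)) euclid
   (fun s D => D \in map (eval s) es /\ target N S r D) (K1 + K2) n s.
- by move=> i hi; rewrite /= qabs1 qabs_ge1 // nz.
- by rewrite /= n0 qabs1 qabs0 -ltNge ltr01.
- move=> i hi; have [|out [t [ex le o]]] := h2 (iter i.+1 euclid s) N S r _ N0.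
    by rewrite inputs_iter.
  exists ([::] ++ out), (K1 + t)%N; split=> //; last by rewrite leq_add2l.
  exact: exec_seq (h1 _) ex.
exists n, out, t; split=> //.
apply: (@le_trans _ _ ((test_ops T + (K1 + K2)).+1 * n.+1)%:R).
  by rewrite ler_nat.
rewrite natrM ler_wpM2l // -nat1r; lra.
Qed.

(** Euclid's steps preserve both congruences a = b r (mod S) and the common divisors of the leading
    coefficients. When the current one is 0, the previous one divides both S and r, so it is a unit
    g, and b / g inverts r modulo S. *)
Lemma bezout n s S r : iter n euclid s 6%N = 0 ->
  (exists k, s 3%N = s 4%N * r + S * k) ->
  (exists k, s 6%N = s 7%N * r + S * k) ->
  (forall g, qdvd g (s 3%N) -> qdvd g (s 6%N) -> qdvd g S /\ qdvd g r) ->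
  qcoprime S r ->
  exists k, r * (iter n euclid s 4%N * qquo 1 (iter n euclid s 3%N)) = 1 + S * k.
Proof.
move=> + + + + cop; elim: n s => [|n IH] s /=.
  move=> s6 [k s3] _ hg; set g := s 3%N in s3 hg *.
  have [||gS gr] := hg g; first by exists 1; rewrite mul1r.
    by exists 0; rewrite s6 mul0r.
  have [c cE] := cop g gS gr.
  have g0 : g != 0 by apply: contra_neq (oner_neq0 Q) => g0; rewrite cE g0 mulr0.
  have -> : qquo 1 g = c by rewrite cE mulrC qquoK.
  exists (- k * c); apply/eqP; rewrite -subr_eq0 cE s3; apply/eqP; ring.
have [_ [e3 e4 _] [e6 e7 _]] := euclidE s.
rewrite -!iterS !iterSr => n0 [k s3] [k' s6] hg; apply: IH => //.
- by exists k'; rewrite e3 e4.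
- exists (k - qquo (s 3%N) (s 6%N) * k'); rewrite e6 e7.
  by move: (qquo _ _) => q; rewrite s3 s6; ring.
- move=> g; rewrite e3 e6 => -[c cE] [c' c'E]; apply: hg; last by exists c.
  exists (c' + qquo (s 3%N) (s 6%N) * c).
  by rewrite mulrDl -c'E -mulrA -cE subrK.
Qed.

(* The rows (a, b, e) satisfy a D + b D' = e (mod S^2).  With the bound
   17 |S| on |a_i b_(i+1)|, the determinant gives |a_(i+1) b_(i+2)| <=
   |S| + (31/32)^2 17 |S| <= 17 |S|. *)
Definition rows_ok S D D' s :=
  [/\ qabs (s 3%N * s 7%N - s 6%N * s 4%N) = qabs S,
      (exists j, s 3%N * D + s 4%N * D' = s 5%N + S ^+ 2 * j),
      (exists j, s 6%N * D + s 7%N * D' = s 8%N + S ^+ 2 * j),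
      qabs (s 3%N) * qabs (s 7%N) <= 17 * qabs S &
      qabs (s 6%N) * qabs (s 7%N) <= 17 * (31 / 32) * qabs S].

(** The determinant only changes sign. The constant 17 works because it exceeds 1 / (1 - (31/32)^2)
    = 1024/63. *)
Lemma rows_ok_step S D D' s :
  s 6%N != 0 -> rows_ok S D D' s -> rows_ok S D D' (euclid s).
Proof.
move=> s6 [det [j jE] [j' j'E] b1 b2]; have decr := euclid_decr s6.
have [_ [e3 e4 e5] [e6 e7 e8]] := euclidE s.
have det' :
    qabs (euclid s 3%N * euclid s 7%N - euclid s 6%N * euclid s 4%N) = qabs S.
  rewrite -det -qabsN e3 e4 e6 e7; congr qabs.
  by move: (qquo _ _) => q; ring.
have b1' : qabs (euclid s 3%N) * qabs (euclid s 7%N) <= 17 * qabs S.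
  have -> : qabs (euclid s 3%N) * qabs (euclid s 7%N) =
      qabs ((euclid s 3%N * euclid s 7%N - euclid s 6%N * euclid s 4%N) +
            euclid s 6%N * euclid s 4%N) by rewrite subrK qabsM.
  apply: (le_trans (qabsD _ _)); rewrite det' qabsM e4.
  have : qabs (euclid s 6%N) * qabs (s 7%N) <=
      31 / 32 * qabs (s 6%N) * qabs (s 7%N) by rewrite ler_wpM2r ?qabs_ge0.
  have := qabs_ge0 S; rewrite -mulrA; lra.
split=> //.
- by exists j'; rewrite e3 e4 e5.
- exists (j - qquo (s 3%N) (s 6%N) * j'); rewrite e6 e7 e8.
  move: (qquo _ _) => q.
  have -> : (s 3%N - q * s 6%N) * D + (s 4%N - q * s 7%N) * D' =
    (s 3%N * D + s 4%N * D') - q * (s 6%N * D + s 7%N * D') by ring.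
  by rewrite jE j'E; ring.
- have : qabs (euclid s 6%N) * qabs (euclid s 7%N) <=
      31 / 32 * qabs (s 6%N) * qabs (euclid s 7%N) by rewrite ler_wpM2r ?qabs_ge0.
  by move: b1'; rewrite e3 -[31 / 32 * _ * _]mulrA; lra.
Qed.

(** While |a| |D| > |S|^2, the next b' satisfies |a| |b'| <= 17 |S|, so |S|^2 |b'| |D'| <= |a| |b'|
    |D| |D'| <= 17 |S|^4, and the bound on b' follows. The search ends at the latest when a = 0. *)
Lemma rows_small n S D D' s : 0 < qabs S -> qabs D * qabs D' < qabs S ^+ 3 ->
  iter n euclid s 6%N = 0 -> rows_ok S D D' s ->
  qabs (s 7%N) * qabs D' <= 17 * qabs S ^+ 2 ->
  exists2 i, (i <= n)%N & let s' := iter i euclid s in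
    [/\ rows_ok S D D' s', qabs (s' 6%N) * qabs D <= qabs S ^+ 2 &
        qabs (s' 7%N) * qabs D' <= 17 * qabs S ^+ 2].
Proof.
move=> S0 small; elim: n s => [|n IH] s n0 ok b.
  by exists 0%N => //; split=> //=; rewrite (n0 : s 6%N = 0) qabs0 mul0r sqr_ge0.
have [h|h] := leP (qabs (s 6%N) * qabs D) (qabs S ^+ 2); first by exists 0%N.
have s6 : s 6%N != 0.
  by apply: contraTneq h => ->; rewrite qabs0 mul0r -leNgt sqr_ge0.
have ok' := rows_ok_step s6 ok.
have [||i hi [okn bD bD']] := IH (euclid s) _ ok'.
- by rewrite -iterSr.
- have [_ _ _ + _] := ok'; have [_ [-> _ _] _] := euclidE s => b1.
  have x := qabs_ge0 (euclid s 7%N); have y := qabs_ge0 D'.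
  rewrite -(ler_pM2l (exprn_gt0 2 S0)).
  apply: (@le_trans _ _
    ((qabs (s 6%N) * qabs (euclid s 7%N)) * (qabs D * qabs D'))).
    rewrite [leRHS]mulrACA ler_wpM2r ?mulr_ge0 //; exact: ltW.
  apply: (@le_trans _ _ (17 * qabs S * qabs S ^+ 3)).
    by apply: ler_pM => //; rewrite ?mulr_ge0 ?qabs_ge0 // ltW.
  by rewrite le_eqVlt; apply/orP; left; apply/eqP; ring.
by exists i.+1 => //; rewrite iterSr.
Qed.

(* If c = a D + b D', then (a D - b D')^2 = c^2 - 4 a b N, so 2 a D = c +- w.
   The last candidate covers a = 0, where c = b D'. *)
Definition candidates (k : Q) : seq (expr R d) :=
  let S2 := Mul (reg 1) (reg 1) in
  let c := Add (Defs.Sub (reg 8) (Mul S2 (Quo (reg 8) S2))) (Mul S2 (Cst k)) in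
  let w := Sqrt (Defs.Sub (Mul c c)
    (Mul (Cst 4) (Mul (Mul (reg 6) (reg 7)) (reg 0)))) in
  [:: Quo (Add c w) (Mul (Cst 2) (reg 6));
      Quo (Defs.Sub c w) (Mul (Cst 2) (reg 6));
      Quo (reg 0) (Quo c (reg 7))].

Lemma candidates_complete S D D' s : s 0%N = D * D' -> s 1%N = S -> S != 0 ->
  D * D' != 0 -> rows_ok S D D' s -> qabs (s 6%N) * qabs D <= qabs S ^+ 2 ->
  qabs (s 7%N) * qabs D' <= 17 * qabs S ^+ 2 ->
  exists2 k, qabs k <= 19 & D \in map (eval s) (candidates k).
Proof.
move=> s0 s1 S0 N0 [det _ [j jE] _ _] bD bD'.
have D'0 : D' != 0 by apply: contraNneq N0 => ->; rewrite mulr0.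
have S2_0 : S ^+ 2 != 0 by rewrite expr2 qmulf_eq0 negb_or S0.
have S_gt0 : 0 < qabs S by rewrite lt_def qabs_eq0 S0 qabs_ge0.
have two0 : (2 : Q) != 0 by rewrite -(qabs_eq0 (2 : Q)) qabs_nat pnatr_eq0.
set q := qquo (s 8%N) (S ^+ 2); set c := s 6%N * D + s 7%N * D'.
have cE : s 8%N - S ^+ 2 * q + S ^+ 2 * (q + j) = c by rewrite /c jE; ring.
(* Here |c| <= (1 + 17) |S|^2 and the remainder of e modulo S^2 is at most |S|^2, whence |k| <= 18 +
   1. *)
exists (q + j).
  have rem := qquo_rem hd (s 8%N) S2_0; rewrite -/q in rem.
  have kE : S ^+ 2 * (q + j) = c - (s 8%N - S ^+ 2 * q) by rewrite -cE; ring.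
  have cle : qabs c <= 18 * qabs S ^+ 2.
    by apply: (le_trans (qabsD _ _)); rewrite !qabsM; lra.
  have S2E : qabs (S ^+ 2) = qabs S ^+ 2 by rewrite !expr2 qabsM.
  rewrite -(ler_pM2l (exprn_gt0 2 S_gt0)) -S2E -qabsM kE.
  apply: (le_trans (qabsB _ _)); rewrite S2E in rem *.
  by have := sqr_ge0 (qabs S); lra.
have cE' : eval s (Add (Defs.Sub (reg 8) (Mul (Mul (reg 1) (reg 1))
      (Quo (reg 8) (Mul (reg 1) (reg 1)))))
      (Mul (Mul (reg 1) (reg 1)) (Cst (q + j)))) = c.
  by rewrite /= s1 -expr2 -/q.
rewrite /candidates; cbv zeta; move: cE'; move: (Add _ _) => ce cE'.
set we := Sqrt _.
have wE : eval s we = qsqrt ((s 6%N * D - s 7%N * D') ^+ 2).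
  by rewrite /we /= cE' s0; congr qsqrt; rewrite /c; ring.
clearbody we; rewrite /= !inE cE' wE s0.
(* If a = 0, the nonzero determinant forces b != 0, so D' = c / b and D = N / D'. *)
have [s6|s6] := eqVneq (s 6%N) 0.
  have s7 : s 7%N != 0.
    apply: contraTneq S_gt0 => s7.
    by rewrite -det s6 s7 mulr0 mul0r subrr qabs0 ltxx.
  apply/or3P/Or33/eqP; rewrite /c s6 mul0r add0r qquoK //.
  by rewrite mulrC qquoK.
have D2 : D = qquo (2 * s 6%N * D) (2 * s 6%N).
  by rewrite qquoK // qmulf_eq0 negb_or two0.
have [->|->] := qsqrt_sqr (s 6%N * D - s 7%N * D').
  apply/or3P/Or31/eqP; rewrite {1}D2; congr qquo; rewrite /c; ring.
apply/or3P/Or32/eqP; rewrite {1}D2; congr qquo; rewrite /c; ring.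
Qed.

(** Register 7 is still 0 on input, so the rows start as (r, 1) and (S, 0). *)
Definition bezout_init : seq (nat * expr R d) :=
  [:: (3, reg 2); (4, Cst 1%R); (6, reg 1)]%N.

(** Register 9 receives the inverse u of r modulo S: the first loop leaves a unit in register 3,
    which the quotient of 1 inverts. *)
Definition rows_init : seq (nat * expr R d) :=
  [:: (9, Mul (reg 4) (Quo (Cst 1%R) (reg 3)));
      (3, Mul (Mul (reg 9) (reg 9)) (reg 0));
      (4, Cst 1%R); (5, Mul (Cst 2%R) (Mul (reg 9) (reg 0)));
      (6, reg 1); (7, Cst 0%R); (8, Mul (reg 1) (reg 2))]%N.

Definition all_candidates (l : seq Q) := flatten (map candidates l).

(* The first loop only computes the inverse of r modulo S. *)
Definition lenstra (l : seq Q) : cmd R d :=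
  Seq (assigns bezout_init) (Seq (euclid_loop [::])
    (Seq (assigns rows_init)
      (Seq (tries (all_candidates l)) (euclid_loop (all_candidates l))))).

Lemma rows_init_ok s N S r D D' : inputs s = (N, S, r) -> N = D * D' ->
  (exists x, D = S * x + r) ->
  (exists k, r * (s 4%N * qquo 1 (s 3%N)) = 1 + S * k) ->
  rows_ok S D D' (run_assigns rows_init s).
Proof.
move=> sE NE [x DE] [k]; set u := s 4%N * _ => uE.
have [s0 s1 s2] := sE; set s' := run_assigns _ _.
have e3 : s' 3%N = u * u * N by rewrite -s0.
have e4 : s' 4%N = 1 by [].
have e5 : s' 5%N = 2 * (u * N) by rewrite -s0.
have e6 : s' 6%N = S by rewrite -s1.
have e7 : s' 7%N = 0 by [].
have e8 : s' 8%N = S * r by rewrite -s1 -s2.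
split.
- by rewrite e4 e6 e7 mulr0 mulr1 sub0r qabsN.
(* The witness comes from D' (u D - 1)^2 with u D - 1 = S (u x + k). *)
- exists (D' * (u * x + k) ^+ 2); rewrite e3 e4 e5.
  have uD : u * D - 1 = S * (u * x + k).
    by rewrite DE mulrDr (mulrC u r) uE; ring.
  have -> : S ^+ 2 * (D' * (u * x + k) ^+ 2) = D' * (u * D - 1) ^+ 2.
    by rewrite uD; ring.
  by rewrite NE; ring.
- by exists x; rewrite e6 e7 e8 DE; ring.
- by rewrite e7 qabs0 mulr0 mulr_ge0 ?qabs_ge0.
- by rewrite e7 qabs0 mulr0 mulr_ge0 ?qabs_ge0 //; lra.
Qed.

Lemma lenstra_exec : exists (l : seq Q) (C : R), 0 <= C /\ forall N S r,
  N != 0 -> qcoprime S r -> qabs N < qabs S ^+ 3 -> exists s' out t,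
  [/\ exec (lenstra l) (input N S r) s' out t,
      forall D, D \in out <-> target N S r D &
      t%:R <= C * (1 + ln (qabs S))].
Proof.
(* The finitely many k with |k| <= 19 are hard-coded as constants of the program. *)
have [l lP] := @quadint_finite R d hd 19.
have [K1 h1] := assigns_exec bezout_init; have [K2 h2] := euclid_loop_exec [::].
have [K3 h3] := assigns_exec rows_init.
have [K4 h4] := tries_exec hd (all_candidates l).
have [K5 h5] := euclid_loop_exec (all_candidates l).
pose iln : R := (ln (32 / 31))^-1.
have iln_ge0 : 0 <= iln by rewrite invr_ge0 ln_ge0 //; lra.
exists l, ((K1 + K3 + K4)%:R + (K2 + K5)%:R * (2 + iln)); split.
  by rewrite addr_ge0 ?mulr_ge0 ?addr_ge0.
move=> N S r N0 cop NS.
have N_gt0 : 0 < qabs N by rewrite lt_def qabs_eq0 N0 qabs_ge0.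
have S0 : S != 0.
  by apply: contraTneq NS => ->; rewrite qabs0 expr0n /= -leNgt qabs_ge0.
have S_gt0 : 0 < qabs S by rewrite lt_def qabs_eq0 S0 qabs_ge0.
set s0 := input N S r; pose s1 := run_assigns bezout_init s0.
have [n [out2 [t2 [n0 ex2 le2 o2]]]] := h2 s1 N S r (erefl _) N0 S0.
pose s2 := iter n euclid s1; pose s3 := run_assigns rows_init s2.
have s2E : inputs s2 = (N, S, r) by rewrite inputs_iter.
have s3E : inputs s3 = (N, S, r) by rewrite -s2E.
have s36 : s3 6%N = S by case: s2E => _ <- _.
have [out4 [t4 [ex4 le4 o4]]] := h4 s3 N S r s3E N0.
have [|m [out5 [t5 [m0 ex5 le5 o5]]]] := h5 s3 N S r s3E N0; first by rewrite s36.
exists (iter m euclid s3), ([::] ++ (out2 ++ ([::] ++ (out4 ++ out5)))),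
  (K1 + (t2 + (K3 + (t4 + t5))))%N; split.
- apply: exec_seq (h1 _) _; apply: exec_seq ex2 _.
  by apply: exec_seq (h3 _) _; apply: exec_seq ex4 ex5.
- have inv : exists k, r * (s2 4%N * qquo 1 (s2 3%N)) = 1 + S * k.
    apply: (bezout n0) => //.
    + by exists 0; rewrite mulr0 addr0 mul1r.
    + by exists 1; rewrite mul0r add0r mulr1.
  move=> D; rewrite /= !mem_cat; split.
    by case/or3P => [/o2[i _ []]|/o4[]|/o5[i _ []]].
  move=> tD; have [[D' NE] rD] := tD; rewrite mulrC in NE.
  have ok := rows_init_ok s2E NE rD inv.
  have small : qabs D * qabs D' < qabs S ^+ 3 by rewrite -qabsM -NE.
  have [|i im [oki bD bD']] := rows_small S_gt0 small m0 ok.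
    by rewrite qabs0 mul0r mulr_ge0 // sqr_ge0.
  have [si0 si1 _] : inputs (iter i euclid s3) = (N, S, r) by rewrite inputs_iter.
  have [||k kle kD] := candidates_complete _ si1 S0 _ oki bD bD'.
  + by rewrite si0.
  + by rewrite -NE.
  have Din : D \in map (eval (iter i euclid s3)) (all_candidates l).
    rewrite map_flatten -map_comp; apply/flatten_mapP.
    by exists k => //; exact: lP.
  (* The loop updates the rows before trying candidates, so the initial row (i = 0) is handled by
     the [tries] before the loop. *)
  case: i im Din {oki bD bD' si0 si1 kD} => [|i] im Din.
    by apply/or3P/Or32/o4.
  by apply/or3P/Or33/o5; exists i.
- move: le2 le5; rewrite (_ : s1 6%N = S) // s36 -/iln.
  set L := ln _ => le2 le5; have L0 : 0 <= L by rewrite ln_ge0 // qabs_ge1.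
  have loopE (K t : nat) : t%:R <= K%:R * (2 + L * iln) ->
      t%:R <= K%:R * ((2 + iln) * (1 + L)).
    move/le_trans; apply; rewrite ler_wpM2l //; nra.
  have {}le2 := loopE _ _ le2; have {}le5 := loopE _ _ le5.
  have le4' : t4%:R <= K4%:R :> R by rewrite ler_nat.
  rewrite !natrD mulrDl.
  have : K1%:R + K3%:R + K4%:R <= (K1%:R + K3%:R + K4%:R) * (1 + L) :> R.
    by rewrite ler_peMr ?addr_ge0 // lerDl.
  rewrite -[_ * (2 + iln) * _]mulrA mulrDl; lra.
Qed.

(** D and the least residue of r differ by a multiple of S, and both have absolute value at most |N|
    < |S| / 2, so the multiple is 0. *)
Lemma single_candidate N S r D :
  N != 0 -> 2 * qabs N < qabs S -> target N S r D ->
  D = r - S * qquo r S.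
Proof.
move=> N0 NS [dv [x DE]]; have DN := qdvd_qabs hd N0 dv.
have S0 : S != 0.
  by apply: contraTneq NS => ->; rewrite qabs0 -leNgt mulr_ge0 ?qabs_ge0.
have rle := qquo_min hd r (- x) S0.
have rE : r - S * - x = D by rewrite DE; ring.
rewrite rE in rle.
have E : S * (x + qquo r S) = D - (r - S * qquo r S) by rewrite DE; ring.
have [z|z] := eqVneq (x + qquo r S) 0.
  by apply/eqP; rewrite -subr_eq0 -E z mulr0.
have Sle : qabs S <= qabs D + qabs (r - S * qquo r S).
  apply: le_trans (qabsB _ _); rewrite -E qabsM ler_peMr ?qabs_ge0 //.
  exact: qabs_ge1.
by exfalso; move: NS DN rle Sle; clear=> *; lra.
Qed.
End Lenstra.

Theorem theorem1p1 (R : realType) (d : int)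
    (hd : d \in [:: -1; -2%:Z; -3%:Z; -7%:Z; -11%:Z]) :
  exists (p : cmd R d) (C : R),
    forall N S r : quadint R d,
      N != 0 -> qcoprime N S -> qcoprime S r ->
      exists (out : seq (quadint R d)) (t : nat),
        [/\ runs p N S r out t,
            (forall D : quadint R d,
               D \in out <-> qdvd D N /\ exists x, D = S * x + r) &
            (* 1 + ln |N|: the logarithm vanishes for units N; for every other
               nonzero N, |N| is at least sqrt 2, so this is O(log |N|) *)
            (qabs N < qabs S ^+ 3 -> t%:R <= C * (1 + ln (qabs N)))].
Proof.
have [w bruteP] := @brute_exec R d hd.
have [l [C [C0 lenstraP]]] := @lenstra_exec R d hd.
pose single : seq (expr R d) :=
  [:: Defs.Sub (Reg R d 2) (Mul (Reg R d 1) (Quo (Reg R d 2) (Reg R d 1)))].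
have [K singleP] := tries_exec hd single.
(* [T1] tests |S|^3 <= |N|, where exhaustive search is allowed; [T2] tests |S| <= 2 |N|, where log
   |S| = O(log |N|). *)
pose T1 := TestAbsLe (Mul (Reg R d 1) (Mul (Reg R d 1) (Reg R d 1))) (Reg R d 0).
pose T2 := TestAbsLe (Reg R d 1) (Mul (Cst 2) (Reg R d 0)).
exists (If T1 (brute w) (If T2 (lenstra l) (tries single))).
pose c := (test_ops T1 + test_ops T2).+2.
(* As ln |S| <= 1 + ln |N| under [T2], the cost C (1 + ln |S|) is at most 2 C (1 + ln |N|); [K] pays
   for the single candidate and [c] for the tests. *)
exists (2 * C + K%:R + c%:R) => N S r N0 _ cop.
have cE t : (test_ops T1 + (test_ops T2 + t).+1).+1 = (c + t)%N.
  by rewrite addnS addnA.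
have c_ge0 := ler0n R c; have K_ge0 := ler0n R K.
have N1 : 0 <= ln (qabs N) by rewrite ln_ge0 // qabs_ge1.
have N_gt0 : 0 < qabs N by rewrite lt_def qabs_eq0 N0 qabs_ge0.
have SSS : qabs (S * (S * S)) = qabs S ^+ 3 by rewrite !qabsM.
have [t1|t1] := boolP (test_eval (input N S r) T1).
  have [s' [out [t [ex o]]]] := bruteP N S r N0.
  exists out, (test_ops T1 + t).+1; split=> //.
    by exists s'; apply: exec_if; rewrite t1.
  by move: t1; rewrite /= SSS leNgt => /negbTE ->.
have NS : qabs N < qabs S ^+ 3 by move: t1; rewrite /= SSS -ltNge.
have [t2|t2] := boolP (test_eval (input N S r) T2).
  have [s' [out [t [ex o le]]]] := lenstraP N S r N0 cop NS.
  exists out, (test_ops T1 + (test_ops T2 + t).+1).+1; split=> // [|_].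
    exists s'; apply: exec_if; rewrite (negbTE t1).
    by apply: exec_if; rewrite t2.
  have SN : qabs S <= 2 * qabs N.
    by move: t2; rewrite /= qabsM (qabs_nat _ _ 2).
  have S_gt0 : 0 < qabs S.
    rewrite lt_def qabs_ge0 andbT; apply: contraTneq NS => ->.
    by rewrite expr0n /= -leNgt qabs_ge0.
  have lnS : ln (qabs S) <= 1 + ln (qabs N).
    apply: (@le_trans _ _ (ln (2 * qabs N))).
      by rewrite ler_ln ?posrE ?mulr_gt0.
    rewrite lnM ?posrE // lerD2r.
    by apply: le_ln1Dx; lra.
  rewrite cE natrD; have : C * (1 + ln (qabs S)) <= C * (2 + ln (qabs N)).
    by rewrite ler_wpM2l //; lra.
  nra.
have [out [t [ex tK o]]] := singleP (input N S r) N S r erefl N0.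
exists out, (test_ops T1 + (test_ops T2 + t).+1).+1; split=> [||_].
- exists (input N S r); apply: exec_if; rewrite (negbTE t1).
  by apply: exec_if; rewrite (negbTE t2).
- move=> D; rewrite o; split=> [[]//|tD]; split=> //.
  rewrite inE /= (single_candidate hd N0 _ tD) //.
  by move: t2; rewrite /= qabsM (qabs_nat _ _ 2) -ltNge.
- have tK' : t%:R <= K%:R :> R by rewrite ler_nat.
  by rewrite cE natrD; nra.
Qed.
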